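(* Let $\Phi\in\mathcal{E}_0(I)$. Then $$\mathcal{C}_\Phi(I)=\mathcal{C}_{\Phi^\Gamma}(I)\qquad\text{and}\qquad \mathcal{A}_\Phi(I)=\mathcal{A}_{\Phi^\Gamma}(I).$$
   Context: $I\subseteq\mathbb{R}$ is a nonempty open interval and $\ell(I)\in(0,\infty]$ is its length. $\mathcal{E}(I)$ is the set of all functions $\Phi:[0,\ell(I))\to[0,\infty)$ (called error functions), and $\mathcal{E}_0(I)$ is the set of those $\Phi\in\mathcal{E}(I)$ with $\Phi(0)=0$. An error function $\Psi\in\mathcal{E}(I)$ possesses property $\Gamma$ if $$\Psi(x+y)\leq\Psi(x)+\frac{2x+y}{y}\Psi(y)\qquad(x\geq0,\ y>0,\ x+y<\ell(I)).$$ The $\Gamma$-envelope $\Phi^\Gamma$ of $\Phi\in\mathcal{E}(I)$ is the pointwise supremum of all error functions $\Psi\in\mathcal{E}(I)$ with property $\Gamma$ satisfying $\Psi\leq\Phi$; it is the largest error function below $\Phi$ with property $\Gamma$. For $\Phi\in\mathcal{E}(I)$, $\mathcal{C}_\Phi(I)$ is the class of $\Phi$-convex functions, i.e., $f:I\to\mathbb{R}$ such that for all $x,y\in I$, $t\in[0,1]$, $$f(tx+(1-t)y)\leq tf(x)+(1-t)f(y)+t\Phi((1-t)|x-y|)+(1-t)\Phi(t|x-y|),$$ and $\mathcal{A}_\Phi(I)$ is the class of $\Phi$-affine functions, i.e., $f:I\to\mathbb{R}$ such that for all $x,y\in I$, $t\in[0,1]$, $$|f(tx+(1-t)y)-tf(x)-(1-t)f(y)|\leq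 t\Phi((1-t)|x-y|)+(1-t)\Phi(t|x-y|).$$ *)

(* Defs.v *)
From HB Require Import structures.
From mathcomp Require Import all_boot all_order all_algebra.
From mathcomp Require Import boolp classical_sets set_interval reals ereal topology normedtype.
Set Implicit Arguments.
Unset Strict Implicit.
Unset Printing Implicit Defensive.
Import Order.TTheory GRing.Theory Num.Theory.
Import numFieldNormedType.Exports.
Local Open Scope classical_set_scope.
Local Open Scope ring_scope.

(* Functions on [0, l(I)[ and on I are represented by total functions R -> R.
   Every condition below only constrains or uses their values on the intended
   domain; the values elsewhere are irrelevant. *)

Definition interval_length (R : realType) (I : set R) : \bar R :=
  (ereal_sup (EFin @` I) - ereal_inf (EFin @` I))%E.

Definition error_domain (R : realType) (I : set R) : set R :=
  [set u | 0 <= u /\ (u%:E < interval_length I)%E].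

Definition error_functions (R : realType) (I : set R) : set (R -> R) :=
  [set Phi | forall u, error_domain I u -> 0 <= Phi u].

Definition error_functions0 (R : realType) (I : set R) : set (R -> R) :=
  [set Phi | error_functions I Phi /\ Phi 0 = 0].

Definition property_Gamma (R : realType) (I : set R) (Psi : R -> R) : Prop :=
  forall x y : R, 0 <= x -> 0 < y -> ((x + y)%:E < interval_length I)%E ->
    Psi (x + y) <= Psi x + (2 * x + y) / y * Psi y.

Definition Gamma_minorants (R : realType) (I : set R) (Phi : R -> R) :
    set (R -> R) :=
  [set Psi | [/\ error_functions I Psi, property_Gamma I Psi &
                 forall u, error_domain I u -> Psi u <= Phi u]].

(* For u in the error domain and Phi an error function, the set below contains
   0 and is bounded above by Phi u, so that sup is a genuine supremum. *)
Definition Gamma_envelope (R : realType) (I : set R) (Phi : R -> R) : R -> R :=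
  fun u => sup [set Psi u | Psi in Gamma_minorants I Phi].

Definition Phi_convex (R : realType) (I : set R) (Phi : R -> R) :
    set (R -> R) :=
  [set f | forall x y t : R, I x -> I y -> 0 <= t <= 1 ->
    f (t * x + (1 - t) * y) <=
      t * f x + (1 - t) * f y +
      t * Phi ((1 - t) * `|x - y|) + (1 - t) * Phi (t * `|x - y|)].

Definition Phi_affine (R : realType) (I : set R) (Phi : R -> R) :
    set (R -> R) :=
  [set f | forall x y t : R, I x -> I y -> 0 <= t <= 1 ->
    `|f (t * x + (1 - t) * y) - t * f x - (1 - t) * f y| <=
      t * Phi ((1 - t) * `|x - y|) + (1 - t) * Phi (t * `|x - y|)].

(* Main.v *)
Require Import Defs.
From HB Require Import structures.
From mathcomp Require Import all_boot all_order all_algebra.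
From mathcomp Require Import boolp classical_sets set_interval reals ereal topology normedtype.
From mathcomp Require Import ring lra.
Set Implicit Arguments.
Unset Strict Implicit.
Unset Printing Implicit Defensive.
Import Order.TTheory GRing.Theory Num.Theory.
Import numFieldNormedType.Exports.
Local Open Scope classical_set_scope.
Local Open Scope ring_scope.

(** Since the envelope lies below [Phi], only one inclusion needs an idea:
    every [Phi]-convex [f] must be shown to be [Psi]-convex for a single
    property-Gamma minorant [Psi] of [Phi], and [Psi] may depend on [f].

    Writing [p] for the convex combination, [Phi]-convexity compares slopes of
    chords issuing from [p]: each left slope lowered by the error lies below
    each right slope raised by the error.  As [Phi 0 = 0], this amounts to the
    existence of approximate subgradients [s p] ([convex_subgradient],
    [subgradient_convex]):
      [f p + s p * (q - p) - f q <= Phi `|p - q|]  for all [p], [q] in [I].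
    Take for [Psi] the smallest nonnegative error function for which these
    same [s p] remain subgradients, that is, [Psi u] is the supremum of the
    left-hand sides over the pairs at distance [u].  Then [Psi <= Phi] and [f]
    is [Psi]-convex.

    Property Gamma of [Psi] is the heart of the matter.  Let [p], [m], [q] be
    successive points with [`|p - m| = y] and [`|m - q| = x].  The gap from [p]
    to [q] is the sum of the gaps from [p] to [m] and from [m] to [q], plus
    [(s p - s m) * (q - m)].  Adding the subgradient inequalities at [p] and at
    [m] for the pair [p], [m] bounds [(s p - s m) * (m - p)] by [2 * Psi y],
    and so that extra term by [(2 * x / y) * Psi y].

    Finally, [f] is affine up to an error exactly when both [f] and [- f] are
    convex up to the same error, which reduces the affine case to the convex
    one. *)

(** * Distances in an open interval and the envelope *)

Lemma open_pts_around (R : realType) (I : set R) (p : R) :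
  open I -> I p -> exists e : R, [/\ 0 < e, I (p - e) & I (p + e)].
Proof.
move=> oI Ip.
have /nbhs_ballP[e /= e0 eI] : nbhs p I by apply: open_nbhs_nbhs.
exists (e / 2); split; first by rewrite divr_gt0.
- apply: eI; rewrite /ball /= opprB addrCA subrr addr0 gtr0_norm; lra.
- apply: eI; rewrite /ball /= opprD addNKr normrN gtr0_norm; lra.
Qed.

(** Openness makes the inequality strict: the larger of the two points can
    still be moved further away inside [I]. *)
Lemma dist_error_domain (R : realType) (I : set R) (p q : R) :
  open I -> I p -> I q -> error_domain I `|p - q|.
Proof.
move=> oI; wlog lepq : p q / p <= q.
  by move=> H Ip Iq; case/orP: (le_total p q) => h; [|rewrite distrC]; exact: H.
move=> Ip Iq; split; first exact: normr_ge0.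
have [e [e0 _ Iqe]] := open_pts_around oI Iq.
apply: (@lt_le_trans _ _ ((q + e)%:E - p%:E)%E).
  rewrite -EFinB lte_fin ler0_norm; lra.
apply: leeB.
  by apply: ereal_sup_ubound; exists (q + e).
by apply: ereal_inf_lbound; exists p.
Qed.

Lemma Gamma_envelope_le (R : realType) (I : set R) (Phi : R -> R) (u : R) :
  error_functions I Phi -> error_domain I u -> Gamma_envelope I Phi u <= Phi u.
Proof.
move=> Phi0 Iu; apply: ge_sup; last by move=> _ [Psi [_ _ le] <-]; exact: le.
exists 0, (fun=> 0) => //; split=> //= x y _ _ _.
by rewrite mulr0 addr0.
Qed.

Lemma le_Gamma_envelope (R : realType) (I : set R) (Phi Psi : R -> R) (u : R) :
  Gamma_minorants I Phi Psi -> error_domain I u -> Psi u <= Gamma_envelope I Phi u.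
Proof.
move=> minPsi Iu; apply: ub_le_sup; last by exists Psi.
by exists (Phi u) => _ [X [_ _ le] <-]; exact: le.
Qed.

(** * Approximate convexity through subgradients *)

Definition subgradient_gap (R : realType) (f s : R -> R) (p q : R) : R :=
  f p + s p * (q - p) - f q.

Definition Phi_subgradient (R : realType) (I : set R) (Phi f s : R -> R) : Prop :=
  forall p q, I p -> I q -> subgradient_gap f s p q <= Phi `|p - q|.

(** The inequality of [Phi_convex] with denominators cleared, in terms of the
    middle point [p] and its distances to the two end points. *)
Lemma Phi_convex_between (R : realType) (I : set R) (Phi f : R -> R) (y p z : R) :
  Phi_convex I Phi f -> I y -> I z -> y < p -> p < z ->
  (z - y) * f p <= (p - y) * (f z + Phi (z - p)) + (z - p) * (f y + Phi (p - y)).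
Proof.
move=> cf Iy Iz yp pz.
have d0 : 0 < z - y by lra.
have t01 : 0 <= (p - y) / (z - y) <= 1.
  by rewrite ler_pdivlMr // ler_pdivrMr // mul0r mul1r; apply/andP; split; lra.
have := cf z y _ Iz Iy t01.
have -> : 1 - (p - y) / (z - y) = (z - p) / (z - y) by field; lra.
rewrite (gtr0_norm d0) !divfK ?gt_eqF //.
have -> : (p - y) / (z - y) * z + (z - p) / (z - y) * y = p by field; lra.
rewrite -(ler_pM2l d0) => /le_trans; apply.
by rewrite le_eqVlt; apply/orP; left; apply/eqP; field; lra.
Qed.

(** The supremum of the lowered left slopes at [p] serves as subgradient; it
    is finite, and below every raised right slope, by convexity.  At [q = p]
    the inequality is the assumption [Phi 0 = 0]. *)
Lemma convex_subgradient (R : realType) (I : set R) (Phi f : R -> R) :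
  open I -> Phi 0 = 0 -> Phi_convex I Phi f -> exists s, Phi_subgradient I Phi f s.
Proof.
move=> oI Phi0 cf.
pose L p := [set (f p - f y - Phi (p - y)) / (p - y) | y in I `&` [set y | y < p]].
have Lub p z : I p -> I z -> p < z -> ubound (L p) ((f z + Phi (z - p) - f p) / (z - p)).
  move=> Ip Iz pz _ [y [Iy /= yp] <-].
  have := Phi_convex_between cf Iy Iz yp pz.
  rewrite ler_pdivrMr ?subr_gt0 // mulrAC ler_pdivlMr ?subr_gt0 //; nra.
exists (fun p => sup (L p)) => p q Ip Iq; rewrite /subgradient_gap.
have [e [e0 Ipl Ipr]] := open_pts_around oI Ip.
case: (ltgtP p q) => [pq|qp|<-]; last by rewrite !subrr normr0 Phi0; lra.
- rewrite ltr0_norm ?subr_lt0 // opprB.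
  have : sup (L p) <= (f q + Phi (q - p) - f p) / (q - p).
    apply: ge_sup; last exact: Lub.
    by eexists; exists (p - e) => //; split=> //=; lra.
  rewrite ler_pdivlMr ?subr_gt0 //; lra.
- rewrite gtr0_norm ?subr_gt0 //.
  have : (f p - f q - Phi (p - q)) / (p - q) <= sup (L p).
    apply: ub_le_sup; last by exists q.
    by eexists; apply: (Lub p (p + e)) => //; lra.
  rewrite ler_pdivrMr ?subr_gt0 //; lra.
Qed.

(** The slope at the convex combination cancels when the subgradient
    inequalities towards the two end points are averaged. *)
Lemma subgradient_convex (R : realType) (I : set R) (Phi f s : R -> R) :
  is_interval I -> Phi_subgradient I Phi f s -> Phi_convex I Phi f.
Proof.
move=> iI sf x y t Ix Iy /andP[t0 t1].
set p := t * x + (1 - t) * y.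
have Ip : I p.
  case/orP: (le_total x y) => xy.
    by apply: (iI x y) => //; rewrite /p; apply/andP; split; nra.
  by apply: (iI y x) => //; rewrite /p; apply/andP; split; nra.
have := sf p x Ip Ix; have := sf p y Ip Iy; rewrite /subgradient_gap.
have -> : `|p - y| = t * `|x - y|.
  by rewrite -(ger0_norm t0) -normrM; congr `|_|; rewrite /p; ring.
have -> : `|p - x| = (1 - t) * `|x - y|.
  rewrite -(@ger0_norm _ (1 - t)) ?subr_ge0 // -normrM distrC.
  by congr `|_|; rewrite /p; ring.
have u0 : 0 <= 1 - t by rewrite subr_ge0.
move=> /(ler_wpM2l u0) hy /(ler_wpM2l t0) hx.
have E : t * (f p + s p * (x - p) - f x) + (1 - t) * (f p + s p * (y - p) - f y)
       = f p - t * f x - (1 - t) * f y by move: (f p) (s p) => fp sp; rewrite /p; ring.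
move: hx hy E; move: (t * (_ + _ - _)) ((1 - t) * (_ + _ - _)) => a b; lra.
Qed.

Lemma Phi_convex_le (R : realType) (I : set R) (Phi Psi : R -> R) :
  open I -> is_interval I -> (forall u, error_domain I u -> Phi u <= Psi u) ->
  Phi_convex I Phi `<=` Phi_convex I Psi.
Proof.
move=> oI iI le f cf x y t Ix Iy t01; apply: (le_trans (cf x y t Ix Iy t01)).
case/andP: t01 => t0 t1; have [d0 dl] := dist_error_domain oI Ix Iy.
have shrink c : 0 <= c -> c <= 1 -> error_domain I (c * `|x - y|).
  move=> c0 c1; split; first by rewrite mulr_ge0.
  by apply: le_lt_trans dl; rewrite lee_fin ler_piMl.
by apply: lerD; [apply: lerD => //|]; apply: ler_wpM2l; rewrite ?subr_ge0 //;
  apply: le; apply: shrink; lra.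
Qed.

(** * The optimal error function of a family of subgradients *)

(** The value [0] is put into the set to make the supremum nonnegative, and
    meaningful even when no two points of [I] are at distance [u]. *)
Definition gap_values (R : realType) (I : set R) (f s : R -> R) (u : R) : set R :=
  [set v | v = 0 \/ exists p q, [/\ I p, I q, `|p - q| = u & v = subgradient_gap f s p q]].

Definition optimal_error (R : realType) (I : set R) (f s : R -> R) (u : R) : R :=
  sup (gap_values I f s u).

Section OptimalError.
Context (R : realType) (I : set R) (Phi f s : R -> R).
Hypotheses (oI : open I) (iI : is_interval I).
Hypotheses (Phi_ge0 : error_functions I Phi) (sf : Phi_subgradient I Phi f s).

Let Psi := optimal_error I f s.

Lemma gap_values_ub u : error_domain I u -> ubound (gap_values I f s u) (Phi u).
Proof.
by move=> Iu _ [->|[p [q [Ip Iq <- ->]]]]; [exact: Phi_ge0 | exact: sf].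
Qed.

Lemma gap_le_optimal_error p q : I p -> I q -> subgradient_gap f s p q <= Psi `|p - q|.
Proof.
move=> Ip Iq; apply: ub_le_sup; last by right; exists p, q.
by exists (Phi `|p - q|); apply: gap_values_ub; exact: dist_error_domain.
Qed.

Lemma optimal_error_ge0 u : error_domain I u -> 0 <= Psi u.
Proof.
by move=> Iu; apply: ub_le_sup; [exists (Phi u); exact: gap_values_ub | left].
Qed.

Lemma optimal_error_le_Phi u : error_domain I u -> Psi u <= Phi u.
Proof. by move=> Iu; apply: ge_sup; [exists 0; left | exact: gap_values_ub]. Qed.

(** The three-point inequality behind property Gamma, for a point [m] at
    distance [y] from [p] on the way to [q].  The parameter [c] gives the
    direction of travel, so that both orders of [p] and [q] are covered. *)
Lemma gap_three_points (c p x y : R) :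
  `|c| = 1 -> 0 <= x -> 0 < y ->
  I p -> I (p + c * y) -> I (p + c * (x + y)) ->
  subgradient_gap f s p (p + c * (x + y)) <= Psi x + (2 * x + y) / y * Psi y.
Proof.
move=> c1 x0 y0 Ip Im Iq.
set m := p + c * y; set q := p + c * (x + y).
have dpm : `|p - m| = y.
  by rewrite /m opprD addNKr normrN normrM c1 mul1r gtr0_norm.
have dmq : `|m - q| = x.
  rewrite (_ : m - q = - (c * x)); last by rewrite /m /q; ring.
  by rewrite normrN normrM c1 mul1r ger0_norm.
have gpm := gap_le_optimal_error Ip Im.
have gmp := gap_le_optimal_error Im Ip.
have gmq := gap_le_optimal_error Im Iq.
rewrite distrC in gmp; rewrite dpm in gpm gmp; rewrite dmq in gmq.
have mono : x / y * (subgradient_gap f s p m + subgradient_gap f s m p)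
    <= x / y * (2 * Psi y).
  by apply: ler_wpM2l; [rewrite divr_ge0 // ltW | lra].
have -> : (2 * x + y) / y * Psi y = Psi y + x / y * (2 * Psi y) by field; lra.
(* The extra term [(s p - s m) * (q - m)] is [x / y] times the sum of the two
   gaps between [p] and [m]. *)
have -> : subgradient_gap f s p q =
    subgradient_gap f s p m + subgradient_gap f s m q +
    x / y * (subgradient_gap f s p m + subgradient_gap f s m p).
  rewrite /subgradient_gap.
  move: (f p) (f m) (f q) (s p) (s m) => fp fm fq sp sm.
  by rewrite /m /q; field; lra.
lra.
Qed.

Lemma optimal_error_Gamma : property_Gamma I Psi.
Proof.
move=> x y x0 y0 xyl.
have dom z : 0 <= z -> z <= x + y -> error_domain I z.
  by move=> z0 zxy; split=> //; apply: le_lt_trans xyl; rewrite lee_fin.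
apply: ge_sup; first by exists 0; left.
move=> _ [->|[p [q [Ip Iq dpq ->]]]].
  apply: addr_ge0; first by apply: optimal_error_ge0; apply: dom; lra.
  apply: mulr_ge0; last by apply: optimal_error_ge0; apply: dom; lra.
  by apply: divr_ge0; lra.
have [c [c1 qE]] : exists c : R, `|c| = 1 /\ q = p + c * (x + y).
  case: (leP p q) => pq.
    exists 1; rewrite normr1; split=> //; move: dpq.
    by rewrite ler0_norm ?subr_le0 //; lra.
  exists (-1); rewrite normrN1; split=> //; move: dpq.
  by rewrite gtr0_norm ?subr_gt0 //; lra.
have Im : I (p + c * y).
  case: (leP 0 c) => c0.
    by apply: (@iI p q) => //; rewrite qE; apply/andP; split; nra.
  by apply: (@iI q p) => //; rewrite qE; apply/andP; split; nra.
by rewrite qE; apply: gap_three_points; rewrite -?qE.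
Qed.

Lemma optimal_error_minorant : Gamma_minorants I Phi Psi.
Proof.
split; [exact: optimal_error_ge0 | exact: optimal_error_Gamma |].
exact: optimal_error_le_Phi.
Qed.

Lemma optimal_error_convex : Phi_convex I Psi f.
Proof. by apply: (@subgradient_convex _ _ _ _ s) => // p q; exact: gap_le_optimal_error. Qed.

End OptimalError.

(** * Equality of the classes *)

Lemma Phi_convex_Gamma_envelope (R : realType) (I : set R) (Phi : R -> R) :
  open I -> is_interval I -> error_functions0 I Phi ->
  Phi_convex I Phi = Phi_convex I (Gamma_envelope I Phi).
Proof.
move=> oI iI [Phi_ge0 Phi0]; apply/seteqP; split; last first.
  by apply: Phi_convex_le => // u; exact: Gamma_envelope_le.
move=> f /(convex_subgradient oI Phi0)[s sf].
apply: (@Phi_convex_le _ _ (optimal_error I f s)) => //.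
  by move=> u; apply: le_Gamma_envelope; exact: optimal_error_minorant.
exact: (@optimal_error_convex _ _ Phi).
Qed.

Lemma Phi_affineE (R : realType) (I : set R) (Phi : R -> R) :
  Phi_affine I Phi = [set f | Phi_convex I Phi f /\ Phi_convex I Phi (\- f)].
Proof.
apply/seteqP; split=> f /=.
  move=> af; split=> x y t Ix Iy t01; have := af x y t Ix Iy t01;
    rewrite ler_norml => /andP[] /=; lra.
move=> [cf cNf] x y t Ix Iy t01; rewrite ler_norml.
have := cf x y t Ix Iy t01; have /= := cNf x y t Ix Iy t01.
by move=> h1 h2; apply/andP; split; lra.
Qed.

Theorem theorem4p8 (R : realType) (I : set R)
    (I_open : open I) (I_interval : is_interval I) (I_nonempty : I !=set0)
    (Phi : R -> R) (Phi_E0 : error_functions0 I Phi) :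
  Phi_convex I Phi = Phi_convex I (Gamma_envelope I Phi) /\
  Phi_affine I Phi = Phi_affine I (Gamma_envelope I Phi).
Proof.
have convexE := Phi_convex_Gamma_envelope I_open I_interval Phi_E0.
by split=> //; rewrite !Phi_affineE convexE.
Qed.
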